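(* Let $n\geq1$ be an integer and let $W$ be a mean zero random variable with finite, non-zero variance $\sigma^2$. Suppose that $(W,W^{*(n)})$ is given on a joint probability space so that $W^{*(n)}$ has the $W$-zero biased distribution of order $n$. Let $h$ be a test function and let $f$ be the solution of the $\mathrm{PN}(n,\sigma^2)$ Stein equation $\sigma^2A_nf(x)-xf(x)=h(x)-\mathrm{PN}_n^{\sigma^2}h$, and suppose that the derivatives of $A_nf$ appearing in the bounds below exist and are bounded. Then $$|\mathbb{E}h(W)-\mathrm{PN}_n^{\sigma^2}h|\leq\sigma^2\|(A_nf)'\|\,\mathbb{E}|W-W^{*(n)}|.$$ Suppose now that $W=\prod_{k=1}^nW_k$, where the $W_k$ are independent. Then $$|\mathbb{E}h(W)-\mathrm{PN}_n^{\sigma^2}h|\leq\sigma^2\|(A_nf)'\|\sqrt{\mathbb{E}\big[\big(\mathbb{E}[W-W^{*(n)}\mid W_1,\ldots,W_n]\big)^2\big]}+\frac{\sigma^2}{2}\|(A_nf)''\|\,\mathbb{E}(W-W^{*(n)})^2.$$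
   Context: $\mathrm{PN}(n,\sigma^2)$ is the distribution of $X_1\cdots X_n$ with $X_i\sim N(0,\sigma_i^2)$ independent and $\sigma=\sigma_1\cdots\sigma_n$; $\mathrm{PN}_n^{\sigma^2}h=\mathbb{E}h(X)$ for $X\sim\mathrm{PN}(n,\sigma^2)$ (the expectations involving $h$ are assumed to exist). $T$ is the operator $Tf(x)=xf'(x)$ and $A_nf(x)=x^{-1}T^nf(x)=\frac{\mathrm{d}}{\mathrm{d}x}(T^{n-1}f(x))$. $W^{*(n)}$ has the $W$-zero biased distribution of order $n$ if for all $n$ times differentiable $f$ for which $\mathbb{E}Wf(W)$ exists (and the right-hand expectation makes sense), $\mathbb{E}Wf(W)=\sigma^2\mathbb{E}A_nf(W^{*(n)})$; this distribution exists and is unique. $\|g\|=\sup_{x\in\mathbb{R}}|g(x)|$. *)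

(* Defs.v *)
From HB Require Import structures.
From mathcomp Require Import all_boot all_order all_algebra.
From mathcomp Require Import all_classical all_reals all_analysis.
Set Implicit Arguments.
Unset Strict Implicit.
Unset Printing Implicit Defensive.
Import Order.TTheory GRing.Theory Num.Theory.
Import numFieldNormedType.Exports.
Local Open Scope classical_set_scope.
Local Open Scope ring_scope.

Definition n_times_derivable (R : realType) (n : nat) (f : R -> R) : Prop :=
  forall k : nat, (k < n)%N -> forall x : R, derivable (derive1n k f) x 1.

Definition opT (R : realType) (f : R -> R) : R -> R := fun x => x * derive1 f x.

(* The form d/dx (T^{n-1} f) is used because, unlike x^{-1} T^n f(x), it also
   makes sense at x = 0; the two agree elsewhere, see opAE. Only meaningful for
   n >= 1. *)
Definition opA (R : realType) (n : nat) (f : R -> R) : R -> R :=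
  derive1 (iter n.-1 (@opT R) f).

Lemma opAE (R : realType) (n : nat) (f : R -> R) (x : R) :
  (0 < n)%N -> x != 0 -> opA n f x = x^-1 * iter n (@opT R) f x.
Proof. by case: n => // n _ x0; rewrite /opA /= /opT mulKf. Qed.

Definition sup_norm (R : realType) (g : R -> R) : \bar R :=
  ereal_sup [set `|g x|%:E | x in [set: R]].

Definition mutually_independent d (T : measurableType d) (R : realType)
    (P : probability T R) (I : finType) (X : I -> {RV P >-> R}) : Prop :=
  forall (J : {set I}) (B : I -> set R), (forall i, measurable (B i)) ->
    P (\bigcap_(i in [set i | i \in J]) (X i @^-1` B i)) =
    (\prod_(i in J) P (X i @^-1` B i))%E.

(* mu is the law PN(n, sigma^2). The second parameter of normal_prob is the
   standard deviation. *)
Definition is_PN (R : realType) (n : nat) (sigma : R)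
    (mu : probability (measurableTypeR R) R) : Prop :=
  exists d (T : measurableType d) (P : probability T R)
    (s : 'I_n -> R) (X : 'I_n -> {RV P >-> R}),
    [/\ forall i, 0 < s i,
        \prod_(i < n) s i = sigma,
        mutually_independent X,
        forall i (B : set R), measurable B ->
          distribution P (X i) B = normal_prob 0 (s i) B
      & forall B : set R, measurable B ->
          mu B = P [set w | B (\prod_(i < n) X i w)]].

Definition PN_stein_solution (R : realType) (n : nat) (sigma : R)
    (mu : probability (measurableTypeR R) R) (h f : R -> R) : Prop :=
  n_times_derivable n f /\
  forall x : R, sigma ^+ 2 * opA n f x - x * f x = h x - \int[mu]_y h y.

Definition zero_biased d (T : measurableType d) (R : realType)
    (P : probability T R) (n : nat) (W Wn : {RV P >-> R}) : Prop :=
  forall f : R -> R, n_times_derivable n f ->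
    P.-integrable setT (fun w => (W w * f (W w))%:E) ->
    P.-integrable setT (fun w => (opA n f (Wn w))%:E) ->
    ('E_P[fun w => (W w * f (W w))%R] =
     'V_P[W] * 'E_P[fun w => opA n f (Wn w)])%E.

Definition sigma_algebra_of d (T : measurableType d) (R : realType)
    (P : probability T R) (I : Type) (X : I -> {RV P >-> R}) : set (set T) :=
  <<s \bigcup_(i in [set: I]) preimage_set_system setT (X i) measurable >>.

(* Y is a version of E[X | G], for a sub-sigma-algebra G. *)
Definition is_cond_expectation d (T : measurableType d) (R : realType)
    (P : probability T R) (G : set (set T)) (X Y : T -> R) : Prop :=
  [/\ P.-integrable setT (EFin \o X),
      P.-integrable setT (EFin \o Y),
      preimage_set_system setT Y measurable `<=` G
    & forall A, G A ->
        (\int[P]_(w in A) (Y w)%:E = \int[P]_(w in A) (X w)%:E)%E].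

(* Main.v *)
Require Import Defs.
From HB Require Import structures.
From mathcomp Require Import all_boot all_order all_algebra.
From mathcomp Require Import all_classical all_reals all_analysis.
From mathcomp Require Import measurable_realfun ring lra.
Import Order.TTheory GRing.Theory Num.Theory.
Import numFieldNormedType.Exports.
Local Open Scope classical_set_scope.
Local Open Scope ring_scope.
Set Implicit Arguments.
Unset Strict Implicit.
Unset Printing Implicit Defensive.

(** Write [g] for [opA n f]. Evaluating the Stein equation at [W] and taking
expectations gives E h(W) - PN h = sigma^2 E g(W) - E (W f(W)), and the
zero-bias identity applied to [f] itself turns the last term into
sigma^2 E g(Wn). Hence ([stein_gap])

    |E h(W) - PN h| = sigma^2 |E (g(W) - g(Wn))|,

and only the difference of [g] at the two coupled points is left to estimate.

For the first bound, [g] is Lipschitz with constant M1, the supremum of |g'|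
([first_order_bound]). For the second, Taylor's formula at [W] gives
g(W) - g(Wn) = g'(W) (W - Wn) - g''(c) (W - Wn)^2 / 2 ([second_order_bound]).
The quadratic term is at most M2 (W - Wn)^2 / 2 with M2 the supremum of |g''|.
In the linear term g'(W) is bounded and measurable with respect to the
sigma-algebra of the factors, since [W] is their product; so W - Wn may be
replaced there by its conditional expectation [Y] ([Rintegral_mul_eq0]), and
E |Y| is at most the L^2 norm of [Y] ([expectation_norm_le_sqrt]).

The identity [stein_gap] requires g(W) and g(Wn) to be integrable. Finite
variance makes [W] integrable, hence g(W) as [g] is Lipschitz; and g(Wn) is
within M1 |W - Wn| of g(W). When M1 |W - Wn| has infinite expectation the
right-hand side of the first bound is infinite and there is nothing to prove;
this product is finite when M1 = 0, even if W - Wn is not integrable. In the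
second bound W - Wn is integrable because it has a conditional expectation. *)

(** * Differential calculus on the line *)

Lemma derivable_lipschitz (R : realType) (g : R -> R) (M : R) :
  (forall x, derivable g x 1) -> (forall x, `|derive1 g x| <= M) ->
  forall x y, `|g x - g y| <= M * `|x - y|.
Proof.
move=> dg gM x y; wlog xy : x y / x <= y => [hw|].
  by case: (leP x y) => [|/ltW] /hw//; rewrite distrC (distrC y).
have [||c _] := @MVT_segment _ g (derive1 g) x y xy.
- by move=> z _; rewrite derive1E; exact/derivableP/dg.
- by apply: derivable_within_continuous => z _; exact: dg.
by move=> gE; rewrite distrC gE normrM (distrC y) ler_wpM2r.
Qed.

(** The point found lies strictly between [a] and [b]; keeping it distinct from
both ends, rather than in an interval, makes the conclusion independent of the
order of [a] and [b]. *)
Lemma Rolle_derivable (R : realType) (p dp : R -> R) (a b : R) : a != b ->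
  (forall t : R, is_derive t 1 p (dp t)) -> p a = p b ->
  exists c, [/\ dp c = 0, c != a & c != b].
Proof.
move=> ab dpP pab; wlog ltab : a b ab pab / a < b => [hw|].
  move: (ab); rewrite neq_lt => /orP[|]; first exact: hw pab.
  by case/(hw _ _ _ (esym pab)) => [|c []]; [rewrite eq_sym|exists c].
have dp1 (t : R) : derivable p t 1 by exact: ex_derive.
have [//||//|c] := @Rolle _ p a b ltab.
  by apply: derivable_within_continuous => z _; exact: dp1.
rewrite in_itv /= => /andP[ac cb] dpc.
exists c; split; [|by rewrite gt_eqF|by rewrite lt_eqF].
by rewrite -(@derive_val _ _ _ _ _ _ _ (dpP c)); exact: derive_val.
Qed.

(** Stated for all [x] and [y], in either order, because the coupled points [W]
and [Wn] compare differently from one outcome to another. *)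
Lemma taylor2 (R : realType) (g : R -> R) :
  (forall x, derivable g x 1) -> (forall x, derivable (derive1 g) x 1) ->
  forall x y, exists c,
    g y = g x + derive1 g x * (y - x)
          + derive1 (derive1 g) c / 2 * (y - x) ^+ 2.
Proof.
move=> dg ddg x y; have [<-|xy] := eqVneq x y.
  by exists x; rewrite subrr; ring.
have yx0 : y - x != 0 by rewrite subr_eq0 eq_sym.
(* K is the value of the second derivative for which the expansion holds
   exactly; p is the expansion at t with this value, so p x = p y, and c is a
   zero of its derivative. *)
pose K := (g y - g x - derive1 g x * (y - x)) * 2 / (y - x) ^+ 2.
pose p (t : R) : R := g t + derive1 g t * (y - t) + K / 2 * (y - t) ^+ 2.
pose dp t := (derive1 (derive1 g) t - K) * (y - t).
have pxy : p x = p y by rewrite /p /K; field.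
have dpP (t : R) : is_derive t 1 p (dp t).
  have h1 : is_derive t 1 g (derive1 g t) by rewrite derive1E; exact/derivableP/dg.
  have h2 : is_derive t 1 (derive1 g) (derive1 (derive1 g) t).
    by rewrite [X in is_derive _ _ _ X]derive1E; exact/derivableP/ddg.
  by rewrite /p; apply: is_derive_eq; rewrite /dp /GRing.scale /=; field.
have [c [/eqP + _ cy]] := Rolle_derivable xy dpP pxy.
rewrite /dp mulf_eq0 !subr_eq0 (eq_sym y) (negbTE cy) orbF => /eqP dK.
by exists c; rewrite dK /K; field.
Qed.

(** * Boundedness, measurability and integrability *)

Lemma sup_norm_bound (R : realType) (g : R -> R) : (sup_norm g < +oo)%E ->
  exists M, [/\ sup_norm g = M%:E, 0 <= M & forall x, `|g x| <= M].
Proof.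
have leg x : (`|g x|%:E <= sup_norm g)%E by apply: ereal_sup_ubound; exists x.
have : (0 <= sup_norm g)%E by apply: le_trans (leg 0); rewrite lee_fin.
move: leg; case: (sup_norm g) => [M| |] leg // M0 _.
by exists M; split.
Qed.

Lemma derivable_measurable (R : realType) (g : R -> R) :
  (forall x : R, derivable g x 1) -> measurable_fun [set: R] g.
Proof.
move=> dg; apply: continuous_measurable_fun => x.
exact/differentiable_continuous/derivable1_diffP.
Qed.

Lemma le_integrable_EFin d (T : measurableType d) (R : realType)
    (P : {measure set T -> \bar R}) (u v : T -> R) :
  measurable_fun [set: T] u -> (forall w, `|u w| <= v w) ->
  P.-integrable setT (EFin \o v) -> P.-integrable setT (EFin \o u).
Proof.
move=> mu uv; apply: le_integrable => //; first exact/measurable_EFinP.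
by move=> w _ /=; rewrite lee_fin (le_trans (uv w))// ler_norm.
Qed.

Lemma integrable_scale d (T : measurableType d) (R : realType)
    (P : {measure set T -> \bar R}) (c : R) (u : T -> R) :
  P.-integrable setT (EFin \o u) ->
  P.-integrable setT (EFin \o (fun w => c * u w)).
Proof. by move=> iu; have := integrableZl measurableT c iu. Qed.

Lemma integrable_lipschitz_comp d (T : measurableType d) (R : realType)
    (P : probability T R) (g : R -> R) (M : R) (V : T -> R) :
  measurable_fun [set: R] g -> (forall x y, `|g x - g y| <= M * `|x - y|) ->
  measurable_fun [set: T] V -> P.-integrable setT (EFin \o V) ->
  P.-integrable setT (EFin \o (g \o V)).
Proof.
move=> mg glip mV iV.
have ic : P.-integrable setT (EFin \o cst `|g 0|).
  exact: finite_measure_integrable_cst.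
apply: (le_integrable_EFin (v := fun w => `|g 0| + M * `|V w|)).
- exact: measurableT_comp.
- move=> w; rewrite -lerBlDl; apply: le_trans (lerB_dist _ _) _.
  by have := glip (V w) 0; rewrite subr0.
- exact: integrableD ic (integrable_scale M (integrable_norm iV)).
Qed.

(** The variance centres [W] at [fine] of its mean, which is a real number [m]
even if the mean is infinite (it is then 0 by convention). So (W - m)^2 is
integrable, and it dominates |W| up to a constant. *)
Lemma integrable_of_finite_variance d (T : measurableType d) (R : realType)
    (P : probability T R) (W : {RV P >-> R}) :
  ('V_P[W] < +oo)%E -> P.-integrable setT (EFin \o W).
Proof.
rewrite /variance unlock unlock => VW; set m := fine _ in VW.
have iD2 : P.-integrable setT (EFin \o (fun w => (W w - m) ^+ 2)).
  apply/integrableP; split.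
    by apply/measurable_EFinP; apply: measurable_funX; apply: measurable_funB.
  apply: le_lt_trans VW; apply: ge0_le_integral => //=.
  - apply/measurable_EFinP; apply: measurableT_comp => //.
    by apply: measurable_funX; apply: measurable_funB.
  - by apply/measurable_EFinP; apply: measurable_funM; apply: measurable_funB.
  - by move=> w _; rewrite lee_fin ger0_norm ?sqr_ge0// expr2.
apply: (le_integrable_EFin (v := fun w => 1 + `|m| + (W w - m) ^+ 2)) => //.
  move=> w; have : `|W w| <= `|W w - m| + `|m|.
    by rewrite -[X in `|X|](subrK m (W w)) ler_normD.
  (* 2 |t| <= 1 + t ^ 2 *)
  have := sqr_ge0 (`|W w - m| - 1); rewrite -(real_normK (num_real (W w - m))).
  by have := normr_ge0 (W w - m); nra.
have ic : P.-integrable setT (EFin \o cst (1 + `|m|)).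
  exact: finite_measure_integrable_cst.
exact: integrableD ic iD2.
Qed.

(** Hoelder's inequality with exponents 2 and 2 against the constant 1. *)
Lemma expectation_norm_le_sqrt d (T : measurableType d) (R : realType)
    (P : probability T R) (Y : T -> R) : measurable_fun [set: T] Y ->
  (\int[P]_w `|Y w|%:E <= sqrte 'E_P[fun w => (Y w ^+ 2)%R])%E.
Proof.
move=> mY.
have h2 : 2^-1 + 2^-1 = 1 :> R by field.
have := hoelder P mY (measurable_cst (1 : R)) (ltr0n _ 2) (ltr0n _ 2) h2.
rewrite Lnorm1 (_ : _ \o cst 1 = cst 1%E)// Lnorm_cst1.
rewrite [X in (_ * X)%E](_ : _ = 1%E); last first.
  by rewrite -(poweR1r 2^-1); congr poweR; exact: probability_setT.
rewrite mule1 unlock /= poweR12_sqrt; last first.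
  by apply: integral_ge0 => w _; rewrite lee_fin powR_ge0.
move=> h; rewrite unlock.
under eq_integral do rewrite -(mulr1 (Y _)).
apply: (le_trans h); rewrite lee_sqrt; last first.
  by apply: integral_ge0 => w _; rewrite lee_fin sqr_ge0.
under eq_integral do rewrite powR_mulrn// real_normK ?num_real//.
by [].
Qed.

(** * Conditional expectation *)

(** If [Z] integrates to 0 over every set of a sigma-algebra, it is orthogonal
to every bounded function [phi] measurable for that sigma-algebra; with [Z] the
difference between a variable and its conditional expectation this is the
pull-out property. Let [s] be the sign of [phi]. It takes the values 1 and -1
on two sets of the sigma-algebra, so the integral of s Z is 0 and subtracting
(M / 2) s from [phi] does not change the integral of phi Z, while it halves the
bound [M]. Repeating this shows that the integral is at most
M / 2 ^ n times the integral of |Z|, for every [n]. *)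
Lemma Rintegral_mul_eq0 d (T : measurableType d) (R : realType)
    (P : {measure set T -> \bar R}) (G : set (set T)) (Z : T -> R) :
  <<s G>> `<=` measurable ->
  P.-integrable setT (EFin \o Z) ->
  (forall A, <<s G>> A -> \int[P]_(w in A) Z w = 0) ->
  forall (phi : g_sigma_algebraType G -> R) (M : R),
    measurable_fun [set: g_sigma_algebraType G] phi ->
    (forall w, `|phi w| <= M) ->
  \int[P]_w (phi w * Z w) = 0.
Proof.
move=> Gm iZ Z0.
have mG (u : g_sigma_algebraType G -> R) :
    measurable_fun [set: g_sigma_algebraType G] u ->
    measurable_fun [set: T] (u : T -> R).
  by move=> mu _ B mB; apply: Gm; exact: mu.
have mZ : measurable_fun [set: T] Z by apply/measurable_EFinP/(measurable_int P).
have int_bounded (u : g_sigma_algebraType G -> R) (M : R) :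
    measurable_fun [set: g_sigma_algebraType G] u ->
    (forall w, `|u w| <= M) ->
    P.-integrable setT (EFin \o (fun w => u w * Z w)).
  move=> /mG mu uM; apply: (le_integrable_EFin (v := fun w => M * `|Z w|)).
  - exact: measurable_funM.
  - by move=> w; rewrite normrM ler_wpM2r.
  - by apply: integrable_scale; exact: integrable_norm.
pose s (u : g_sigma_algebraType G -> R) w : R := if 0 <= u w then 1 else - 1.
have ms u : measurable_fun [set: g_sigma_algebraType G] u ->
    measurable_fun [set: g_sigma_algebraType G] (s u).
  by move=> mu; apply: measurable_fun_ifT => //; exact: measurable_fun_ler.
have sZ0 u : measurable_fun [set: g_sigma_algebraType G] u ->
    \int[P]_w (s u w * Z w) = 0.
  move=> mu; pose A : set T := [set w | 0 <= u w].
  have GA : <<s G>> A.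
    rewrite -[A]setTI.
    exact: (@measurable_fun_le _ (g_sigma_algebraType G) R setT (cst 0) u).
  have mA : measurable A by exact: Gm.
  have iZA : P.-integrable setT (EFin \o (Z \_ A)).
    rewrite (_ : _ \o _ = (EFin \o Z) \_ A); last by rewrite restrict_EFin.
    by apply/(integrable_mkcond _ mA); exact: integrableS iZ.
  (* s = 2 * 1_A - 1 *)
  transitivity (\int[P]_w (2 * (Z \_ A) w - Z w)).
    apply: eq_Rintegral => w _; rewrite /s patchE.
    case: ifPn => [Aw|/negP Aw].
      by rewrite mem_set//; ring.
    by rewrite memNset// mulN1r mulr0 sub0r.
  rewrite RintegralB//; last exact: integrable_scale.
  rewrite RintegralZl// -Rintegral_mkcond !Z0 ?mulr0 ?subr0//.
  exact: (@measurableT _ (g_sigma_algebraType G)).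
have key n (u : g_sigma_algebraType G -> R) (M : R) :
    measurable_fun [set: g_sigma_algebraType G] u ->
    (forall w, `|u w| <= M) ->
    `|\int[P]_w (u w * Z w)| <= M / 2 ^+ n * \int[P]_w `|Z w|.
  elim: n u M => [|n ih] u M mu uM.
    have iuZ := int_bounded _ _ mu uM.
    rewrite divr1 -RintegralZl//; last exact: integrable_norm.
    apply: (le_trans (le_normr_Rintegral _ iuZ)) => //; apply: le_Rintegral => //.
    - exact: integrable_norm.
    - by apply: integrable_scale; exact: integrable_norm.
    - by move=> w _; rewrite normrM ler_wpM2r.
  have mu' : measurable_fun [set: g_sigma_algebraType G]
      (fun w => u w - M / 2 * s u w).
    by apply: measurable_funB => //; apply: measurable_funM => //; exact: ms.
  have uM' w : `|u w - M / 2 * s u w| <= M / 2.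
    move: (uM w); rewrite /s !ler_norml; case: ifPn => [|] ?; lra.
  have s1 w : `|s u w| <= 1 by rewrite /s; case: ifP; rewrite ?normrN normr1.
  have := ih _ _ mu' uM'.
  rewrite [X in `|X|](_ : _ = \int[P]_w (u w * Z w)).
    by move/le_trans; apply; rewrite exprS invfM mulrA.
  transitivity (\int[P]_w (u w * Z w - M / 2 * (s u w * Z w))).
    by apply: eq_Rintegral => w _; ring.
  have isZ := int_bounded _ _ (ms _ mu) s1.
  rewrite RintegralB//; [|exact: int_bounded uM|exact: integrable_scale].
  by rewrite RintegralZl// sZ0// mulr0 subr0.
move=> phi M mphi phiM; apply/eqP; rewrite -normr_eq0 eq_le normr_ge0 andbT leNgt.
apply/negP => a0.
(* n + 1 < 2 ^ (n + 1), so some 2 ^ (n + 1) exceeds C / a. *)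
set a := `|_| in a0; set C := M * \int[P]_w `|Z w|.
have := key (Num.truncn (C / a)).+1 phi M mphi phiM.
rewrite -/a leNgt => /negP; apply.
rewrite mulrAC -/C ltr_pdivrMr ?exprn_gt0// mulrC -ltr_pdivrMr//.
apply: lt_le_trans (truncnS_gt _) _.
by rewrite -natrX ler_nat ltnW// ltn_expl.
Qed.

Lemma measurable_prod_RV d (T : measurableType d) (R : realType)
    (P : probability T R) (n : nat) (X : 'I_n -> {RV P >-> R}) :
  measurable_fun
    [set: g_sigma_algebraType
       (\bigcup_(i in [set: 'I_n]) preimage_set_system setT (X i) measurable)]
    (fun w => \prod_(k < n) X k w : R).
Proof.
apply: measurable_prod => i _ _ B mB; apply: sub_sigma_algebra.
by exists i => //; exists B.
Qed.

Lemma sigma_algebra_of_sub d (T : measurableType d) (R : realType)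
    (P : probability T R) (I : Type) (X : I -> {RV P >-> R}) :
  sigma_algebra_of X `<=` measurable.
Proof.
apply: smallest_sub; first exact: sigma_algebra_measurable.
by move=> _ [i _ [B mB <-]]; exact: measurable_funPT.
Qed.

(** * The Stein discrepancy *)

Lemma stein_gap (R : realType) (n : nat) (d : measure_display)
    (T : measurableType d) (P : probability T R) (W Wn : {RV P >-> R})
    (sigma : R) (mu : probability (measurableTypeR R) R) (h f : R -> R) :
  'V_P[W] = (sigma ^+ 2)%:E -> zero_biased n W Wn ->
  PN_stein_solution n sigma mu h f ->
  P.-integrable setT (fun w => (h (W w))%:E) ->
  P.-integrable setT (fun w => (opA n f (W w))%:E) ->
  P.-integrable setT (fun w => (opA n f (Wn w))%:E) ->
  (`| 'E_P[fun w => h (W w)] - (\int[mu]_x h x)%R%:E | =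
    (sigma ^+ 2)%:E *
      `|\int[P]_w (opA n f (W w) - opA n f (Wn w))%R|%:E)%E.
Proof.
move=> VW zb [df eqf] ihW igW igWn.
set c := \int[mu]_x h x.
have wfE w : W w * f (W w) = sigma ^+ 2 * opA n f (W w) - (h (W w) - c).
  by rewrite -eqf; ring.
have isg := integrable_scale (sigma ^+ 2) igW.
have ihc : P.-integrable setT (EFin \o (fun w => h (W w) - c)).
  have ic : P.-integrable setT (EFin \o cst c).
    exact: finite_measure_integrable_cst.
  exact: integrableB ihW ic.
have iwf : P.-integrable setT (fun w => (W w * f (W w))%:E).
  under eq_fun do rewrite wfE.
  exact: integrableB isg ihc.
(* The Stein equation makes W f(W) integrable, as the zero-bias identity
   requires. *)
have := zb f df iwf igWn.
rewrite VW !unlock.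
have EE (u : T -> R) : P.-integrable setT (EFin \o u) ->
    (\int[P]_w (u w)%:E)%E = (\int[P]_w u w)%:E.
  by move=> iu; rewrite /Rintegral fineK//; exact: integrable_fin_num.
have cE : \int[P]_w c = c.
  by rewrite Rintegral_cst// [X in fine X]probability_setT mulr1.
have solve (x y a b : R) : x * a - y = x * b -> y = x * (a - b).
  by move=> e; rewrite mulrBr -e subKr.
rewrite !EE// -!EFinM => -[].
under eq_Rintegral do rewrite wfE.
rewrite !RintegralB//; last exact: finite_measure_integrable_cst.
rewrite RintegralZl// cE => h1.
rewrite -EFinB abse_EFin; congr (_%:E).
rewrite -[in RHS](ger0_norm (sqr_ge0 sigma)) -normrM; congr `|_|.
exact: solve h1.
Qed.

Lemma first_order_bound d (T : measurableType d) (R : realType)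
    (P : probability T R) (V W : {RV P >-> R}) (g : R -> R) (M : R) :
  (forall x y, `|g x - g y| <= M * `|x - y|) ->
  P.-integrable setT (EFin \o (fun w => g (V w) - g (W w))) ->
  ((`|\int[P]_w (g (V w) - g (W w))|)%:E <=
    M%:E * 'E_P[fun w => `|V w - W w|%R])%E.
Proof.
move=> glip igg.
have M0 : 0 <= M by have := glip 1 0; rewrite subr0 normr1 mulr1; exact: le_trans.
have mD : measurable_fun [set: T] (fun w => `|V w - W w|).
  by apply: measurableT_comp => //; exact: measurable_funB.
rewrite unlock -ge0_integralZl//; last exact/measurable_EFinP.
rewrite EFin_normr_Rintegral//.
apply: (le_trans (le_abse_integral P measurableT (measurable_int _ igg))).
apply: ge0_le_integral => //=.
- apply/measurable_EFinP; apply: measurableT_comp => //.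
  exact/measurable_EFinP/(measurable_int _ igg).
- by apply/measurable_EFinP; exact: measurable_funM.
- by move=> w _; rewrite lee_fin.
Qed.

(** The bound is in the extended reals to cover infinite second moments: the
linear and quadratic parts are each dominated by the integral of a nonnegative
function. *)
Lemma second_order_bound d (T : measurableType d) (R : realType)
    (P : probability T R) (W Wn : {RV P >-> R}) (G : set (set T)) (Y : T -> R)
    (g : R -> R) (M1 M2 : R) :
  (forall x : R, derivable g x 1) ->
  (forall x : R, derivable (derive1 g) x 1) ->
  (forall x, `|derive1 g x| <= M1) ->
  (forall x, `|derive1 (derive1 g) x| <= M2) ->
  <<s G>> `<=` measurable ->
  measurable_fun [set: g_sigma_algebraType G] (W : T -> R) ->
  is_cond_expectation P <<s G>> (fun w => W w - Wn w) Y ->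
  P.-integrable setT (EFin \o (fun w => g (W w) - g (Wn w))) ->
  ((`|\int[P]_w (g (W w) - g (Wn w))|)%:E <=
    M1%:E * sqrte 'E_P[fun w => (Y w ^+ 2)%R] +
    (M2 / 2)%:E * 'E_P[fun w => ((W w - Wn w) ^+ 2)%R])%E.
Proof.
move=> dg ddg gM1 gM2 Gm mW [iD iY _ YE] igg.
have M1ge0 : 0 <= M1 by apply: le_trans (gM1 0).
have M2ge0 : 0 <= M2 by apply: le_trans (gM2 0).
have mD : measurable_fun [set: T] (fun w => W w - Wn w).
  exact: measurable_funB.
pose D w := W w - Wn w.
pose phi w := derive1 g (W w).
pose r w := g (W w) - g (Wn w) - phi w * D w.
have mdg : measurable_fun [set: R] (derive1 g) by exact: derivable_measurable.
have mphi : measurable_fun [set: T] phi by exact: measurableT_comp.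
have mY : measurable_fun [set: T] Y by apply/measurable_EFinP/(measurable_int P).
have int_phi Z : P.-integrable setT (EFin \o Z) ->
    P.-integrable setT (EFin \o (fun w => phi w * Z w)).
  move=> iZ; apply: (le_integrable_EFin (v := fun w => M1 * `|Z w|)).
  - by apply: measurable_funM => //; apply/measurable_EFinP/(measurable_int P).
  - by move=> w; rewrite normrM ler_wpM2r//; exact: gM1.
  - exact/integrable_scale/integrable_norm.
have iphiD := int_phi _ iD; have iphiY := int_phi _ iY.
have ir : P.-integrable setT (EFin \o r) by exact: integrableB igg iphiD.
have rle w : `|r w| <= M2 / 2 * D w ^+ 2.
  have [c gc] := taylor2 dg ddg (W w) (Wn w).
  have -> : r w = - (derive1 (derive1 g) c / 2 * D w ^+ 2).
    by rewrite /r gc /phi /D; ring.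
  rewrite normrN normrM (ger0_norm (sqr_ge0 _)) ler_wpM2r ?sqr_ge0//.
  by rewrite normrM [X in _ * X]ger0_norm ?invr_ge0// ler_wpM2r ?invr_ge0.
have phiDY : \int[P]_w (phi w * D w) = \int[P]_w (phi w * Y w).
  apply/eqP; rewrite -subr_eq0 -RintegralB//; apply/eqP.
  under eq_Rintegral do rewrite -mulrBr.
  apply: (Rintegral_mul_eq0 Gm _ _ (M := M1)).
  - exact: integrableB iD iY.
  - move=> A GA; have mA := Gm _ GA.
    rewrite RintegralB//; [|exact: integrableS iD|exact: integrableS iY].
    by rewrite /Rintegral (YE _ GA) subrr.
  - exact: measurableT_comp mdg mW.
  - by move=> w; exact: gM1.
have uE : \int[P]_w (g (W w) - g (Wn w)) =
    \int[P]_w (phi w * Y w) + \int[P]_w r w.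
  by rewrite -phiDY -RintegralD//; apply: eq_Rintegral => w _; rewrite /r; ring.
have phiYle : ((`|\int[P]_w (phi w * Y w)|)%:E <=
    M1%:E * sqrte 'E_P[fun w => (Y w ^+ 2)%R])%E.
  apply: le_trans (lee_wpmul2l _ (expectation_norm_le_sqrt P mY)); last first.
    by rewrite lee_fin.
  rewrite -ge0_integralZl//; last by apply/measurable_EFinP; exact: measurableT_comp.
  rewrite EFin_normr_Rintegral//.
  apply: (le_trans (le_abse_integral P measurableT (measurable_int _ iphiY))).
  apply: ge0_le_integral => //=.
  - by apply/measurable_EFinP; apply: measurableT_comp => //; exact: measurable_funM.
  - by apply/measurable_EFinP; apply: measurable_funM => //; exact: measurableT_comp.
  - by move=> w _; rewrite lee_fin normrM ler_wpM2r//; exact: gM1.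
have intr_le : ((`|\int[P]_w r w|)%:E <=
    (M2 / 2)%:E * 'E_P[fun w => (D w ^+ 2)%R])%E.
  have mD2 : measurable_fun [set: T] (fun w => D w ^+ 2) by exact: measurable_funX.
  rewrite unlock -ge0_integralZl ?lee_fin ?divr_ge0//; last 2 first.
  - exact/measurable_EFinP.
  - by move=> w _; rewrite lee_fin sqr_ge0.
  rewrite EFin_normr_Rintegral//.
  apply: (le_trans (le_abse_integral P measurableT (measurable_int _ ir))).
  apply: ge0_le_integral => //=.
  - apply/measurable_EFinP; apply: measurableT_comp => //.
    exact/measurable_EFinP/(measurable_int P).
  - by apply/measurable_EFinP; apply: measurable_funM => //.
  - by move=> w _; rewrite lee_fin.
rewrite uE; apply: le_trans (leeD phiYle intr_le).
by rewrite -EFinD lee_fin ler_normD.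
Qed.

Theorem theorem4p1 (R : realType) (n : nat) (hn : (1 <= n)%N)
    (d : measure_display) (T : measurableType d) (P : probability T R)
    (W Wn : {RV P >-> R}) (sigma : R) (hsigma : 0 < sigma)
    (hmean : ('E_P[W] = 0)%E) (hvar : 'V_P[W] = (sigma ^+ 2)%:E)
    (hWn : zero_biased n W Wn)
    (mu : probability (measurableTypeR R) R) (hmu : is_PN n sigma mu)
    (h : R -> R)
    (hhW : P.-integrable setT (fun w => (h (W w))%:E))
    (hhmu : mu.-integrable setT (fun x => (h x)%:E))
    (f : R -> R) (hf : PN_stein_solution n sigma mu h f)
    (hA1 : forall x : R, derivable (opA n f) x 1)
    (hA1b : (sup_norm (derive1 (opA n f)) < +oo)%E) :
  (`| 'E_P[fun w => h (W w)] - (\int[mu]_x h x)%R%:E | <=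
     (sigma ^+ 2)%:E * sup_norm (derive1 (opA n f)) *
       'E_P[fun w => `| W w - Wn w |%R])%E
  /\
  forall (Wk : 'I_n -> {RV P >-> R}),
    mutually_independent Wk ->
    (forall w, W w = \prod_(k < n) Wk k w) ->
    (forall x : R, derivable (derive1 (opA n f)) x 1) ->
    (sup_norm (derive1n 2 (opA n f)) < +oo)%E ->
    forall Y : T -> R,
      is_cond_expectation P (sigma_algebra_of Wk) (fun w => W w - Wn w) Y ->
      (`| 'E_P[fun w => h (W w)] - (\int[mu]_x h x)%R%:E | <=
         (sigma ^+ 2)%:E * sup_norm (derive1 (opA n f)) *
           sqrte 'E_P[fun w => (Y w ^+ 2)%R] +
         (sigma ^+ 2 / 2)%:E * sup_norm (derive1n 2 (opA n f)) *
           'E_P[fun w => ((W w - Wn w) ^+ 2)%R])%E.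
Proof.
have [M1 [NM1 M1ge0 gM1]] := sup_norm_bound hA1b.
have glip := derivable_lipschitz hA1 gM1.
have mg : measurable_fun [set: R] (opA n f) by exact: derivable_measurable.
have iW : P.-integrable setT (EFin \o W).
  by apply: integrable_of_finite_variance; rewrite hvar ltry.
have igW : P.-integrable setT (fun w => (opA n f (W w))%:E).
  exact: integrable_lipschitz_comp mg glip (measurable_funPT W) iW.
have igWn_of : P.-integrable setT (EFin \o (fun w => M1 * `|W w - Wn w|)) ->
    P.-integrable setT (fun w => (opA n f (Wn w))%:E).
  move=> iD; apply: (le_integrable_EFin
    (v := fun w => `|opA n f (W w)| + M1 * `|W w - Wn w|)).
  - exact: measurableT_comp.
  - move=> w; rewrite -lerBlDl; apply: le_trans (lerB_dist _ _) _.
    by rewrite (distrC (W w)); exact: glip.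
  - exact: integrableD (integrable_norm igW) iD.
have s2gt0 : 0 < sigma ^+ 2 by exact: exprn_gt0.
have iB : P.-integrable setT (fun w => (opA n f (Wn w))%:E) ->
    P.-integrable setT (EFin \o (fun w => opA n f (W w) - opA n f (Wn w))).
  by move=> igWn; exact: integrableB igW igWn.
split.
  rewrite NM1.
  have mMD : measurable_fun [set: T] (fun w => M1 * `|W w - Wn w|).
    apply: measurable_funM => //; apply: measurableT_comp => //.
    exact: measurable_funB.
  have ED : (M1%:E * 'E_P[fun w => `|W w - Wn w|%R] =
             \int[P]_w (M1 * `|W w - Wn w|)%R%:E)%E.
    rewrite unlock -ge0_integralZl//; apply/measurable_EFinP.
    by apply: measurableT_comp => //; exact: measurable_funB.
  have [DM|] := ltP (M1%:E * 'E_P[fun w => `|W w - Wn w|%R])%E +oo%E.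
    have igWn : P.-integrable setT (fun w => (opA n f (Wn w))%:E).
      apply: igWn_of; apply/integrableP; split; first exact/measurable_EFinP.
      rewrite ED in DM; apply: le_lt_trans DM; rewrite le_eqVlt; apply/orP; left.
      apply/eqP; apply: eq_integral => w _ /=.
      by rewrite ger0_norm// mulr_ge0.
    rewrite (stein_gap hvar hWn hf hhW igW igWn) -muleA lee_pmul2l ?lte_fin//.
    exact: first_order_bound glip (iB igWn).
  rewrite leye_eq -muleA => /eqP ->.
  by rewrite gt0_muley ?leey// lte_fin.
move=> Wk _ WE ddg hA2b Y YP.
have [M2 [NM2 M2ge0 gM2]] := sup_norm_bound hA2b.
have igWn : P.-integrable setT (fun w => (opA n f (Wn w))%:E).
  by apply/igWn_of/integrable_scale/integrable_norm; case: YP.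
rewrite (stein_gap hvar hWn hf hhW igW igWn).
have mW : measurable_fun [set: g_sigma_algebraType
    (\bigcup_(i in [set: 'I_n]) preimage_set_system setT (Wk i) measurable)]
    (W : T -> R).
  by rewrite (_ : (W : T -> R) = fun w => \prod_(k < n) Wk k w);
    [exact: measurable_prod_RV|exact/funext].
have := second_order_bound hA1 ddg gM1 gM2 (@sigma_algebra_of_sub _ _ _ _ _ Wk)
  mW YP (iB igWn).
have s2ge0 : (0 <= (sigma ^+ 2)%:E)%E by rewrite lee_fin ltW.
move=> /(lee_wpmul2l s2ge0); rewrite ge0_muleDr; last 2 first.
- by apply: mule_ge0 (sqrte_ge0 _); rewrite lee_fin.
- apply: mule_ge0; first by rewrite lee_fin divr_ge0.
  by apply: expectation_ge0 => w; exact: sqr_ge0.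
rewrite !muleA.
rewrite (_ : (sigma ^+ 2)%:E * (M2 / 2)%:E = (sigma ^+ 2 / 2)%:E * M2%:E)%E.
  by rewrite -NM1 -NM2.
by rewrite -!EFinM; congr EFin; field.
Qed.
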